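(* Let $P$ be a rational function with complex coefficients which has only simple critical values. Then the curve $h_P(x,y)=0$ is irreducible.
   Context: A rational function $F$ is regarded as a holomorphic map $\mathbb{CP}^1\to\mathbb{CP}^1$ of degree $\deg F$. A point $s\in\mathbb{CP}^1$ is called a critical value of $F$ if $F^{-1}\{s\}$ contains fewer than $\deg F$ points, and a simple critical value if $F^{-1}\{s\}$ contains exactly $\deg F-1$ points. Write $P=P_1/P_2$ with $P_1,P_2$ polynomials without common roots. The curve $h_P(x,y)=0$ is the affine algebraic curve $$h_P(x,y):\ \frac{P_1(x)P_2(y)-P_2(x)P_1(y)}{x-y}=0.$$ *)

(* Defs.v *)
From HB Require Import structures.
From mathcomp Require Import all_boot all_order all_algebra.
From mathcomp Require Import polyXY.
From mathcomp Require Import all_classical all_reals.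
From mathcomp.real_closed Require Export complex.

Set Implicit Arguments.
Unset Strict Implicit.
Unset Printing Implicit Defensive.

Import GRing.Theory.
Local Open Scope classical_set_scope.
Local Open Scope card_scope.
Local Open Scope ring_scope.

Section RationalFunctions.
Variable F : fieldType.

(* A rational function is given by a numerator and a denominator. *)
Definition no_common_root (P1 P2 : {poly F}) : Prop :=
  forall x : F, ~ (root P1 x /\ root P2 x).

(* The degree of the map induced by P1 / P2 on the projective line, when P1
   and P2 have no common root: the maximum of the two degrees. *)
Definition ratdeg (P1 P2 : {poly F}) : nat := (maxn (size P1) (size P2)).-1.

(* [option F] is the projective line, with [None] as the point at infinity. *)
Definition ratmap (P1 P2 : {poly F}) (z : option F) : option F :=
  match z with
  | Some x => if P2.[x] == 0 then None else Some (P1.[x] / P2.[x])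
  | None =>
      (* [1 : 0] is sent to [a : b], with a and b the coefficients of degree
         ratdeg P1 P2 of P1 and P2. *)
      let n := ratdeg P1 P2 in
      if P2`_n == 0 then None else Some (P1`_n / P2`_n)
  end.

Definition critical_value (P1 P2 : {poly F}) (s : option F) : Prop :=
  exists2 k : nat, (k < ratdeg P1 P2)%N & ratmap P1 P2 @^-1` [set s] #= `I_k.

(* The truncated predecessor is harmless: a map of degree 0 has no critical
   value. *)
Definition simple_critical_value (P1 P2 : {poly F}) (s : option F) : Prop :=
  critical_value P1 P2 s /\
  ratmap P1 P2 @^-1` [set s] #= `I_(ratdeg P1 P2).-1.

Definition only_simple_critical_values (P1 P2 : {poly F}) : Prop :=
  forall s, critical_value P1 P2 s -> simple_critical_value P1 P2 s.

(* Bivariate polynomials follow polyXY: x is 'X and y is 'Y = 'X%:P, so that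
   P(x) is P^:P and P(y) is P%:P. *)
Definition h_num (P1 P2 : {poly F}) : {poly {poly F}} :=
  P1^:P * P2%:P - P2^:P * P1%:P.

Definition h_poly (P1 P2 : {poly F}) : {poly {poly F}} :=
  h_num P1 P2 %/ ('X - 'Y).

(* The division is exact. *)
Lemma h_polyK (P1 P2 : {poly F}) :
  h_poly P1 P2 * ('X - 'Y) = h_num P1 P2.
Proof.
apply/esym/eqP; rewrite -Pdiv.IdomainMonic.dvdp_eq ?monicXsubC //.
have eva (p : {poly F}) : (p^:P).['X] = p by exact: comp_polyXr.
by rewrite dvdp_XsubCl /root /h_num !hornerE !eva mulrC subrr.
Qed.

End RationalFunctions.

(* Zero and the units are excluded; the units of {poly {poly F}} are the
   nonzero constants. *)
Definition irreducible_elt (D : idomainType) (f : D) : Prop :=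
  [/\ f != 0, f \isn't a GRing.unit &
      forall a b : D, f = a * b -> a \is a GRing.unit \/ b \is a GRing.unit].

(* The plane curve f(x, y) = 0 is irreducible when its equation is. *)
Definition irreducible_curve (F : fieldType) (f : {poly {poly F}}) : Prop :=
  irreducible_elt f.

(* Main.v *)
(* The closure of [h_P = 0] in P^1 x P^1 is smooth: at a singular point [(x, y)]
   the fibre of [P] through [x] and [y] would have either two multiple points or
   a point of multiplicity at least 3, hence at most [deg P - 2] points.  A
   factorization [h_P = A B] into nonconstant polynomials would have both partial
   degrees of [A] and of [B] positive, since [P1] and [P2] are linearly
   independent; then [A = 0] and [B = 0] would meet in P^1 x P^1, necessarily at
   a singular point of [h_P = 0]. *)
Require Import Defs.
From mathcomp Require Import all_boot all_order all_algebra.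
From mathcomp Require Import polyXY finmap zify ring.
From mathcomp Require Import all_classical all_reals.

Import GRing.Theory.
Local Open Scope classical_set_scope.
Local Open Scope card_scope.
Local Open Scope ring_scope.

(** * Finite sets of roots and points of the projective line *)

Lemma card_eq_uniq {T : choiceType} {s : seq T} :
  uniq s -> ([set` s] #= `I_(size s))%card.
Proof.
move=> us; have -> : [set` s] = [set` seq_fset tt s].
  by apply/seteqP; split=> x /=; rewrite ?(perm_mem (seq_fset_perm tt s)) mem_undup.
by apply/card_eq_fsetP; rewrite (size_seq_fset tt s) undup_id.
Qed.

Lemma closed_field_roots {F : closedFieldType} {p : {poly F}} : p != 0 ->
  exists2 s : seq F, uniq s & s =i root p.
Proof.
move=> p0; have [s ps] := closed_field_poly_normal p.
exists (undup s); first exact: undup_uniq.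
move=> x; rewrite mem_undup [in RHS]ps -[RHS]topredE /=.
by rewrite rootZ ?lead_coef_eq0 ?root_prod_XsubC.
Qed.

Lemma proj_eq {F : fieldType} (a b c d : F) : (a, b) != 0 -> (c, d) != 0 ->
  ((if b == 0 then None else Some (a / b)) =
   (if d == 0 then None else Some (c / d))) <-> d * a - c * b = 0.
Proof.
rewrite !xpair_eqE /=.
have [->|b0] := eqVneq b 0; have [->|d0] := eqVneq d 0; rewrite ?andbT ?andbF /=.
- by rewrite !(mul0r, mulr0) subrr.
- move=> a0 _; split=> //; rewrite mulr0 subr0 => /eqP.
  by rewrite mulf_eq0 (negPf a0) (negPf d0).
- move=> _ c0; split=> //; rewrite mul0r sub0r => /eqP.
  by rewrite oppr_eq0 mulf_eq0 (negPf b0) (negPf c0).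
- move=> _ _; split=> [[/eqP]|/eqP].
    by rewrite eqr_div // mulrC => /eqP ->; rewrite subrr.
  by rewrite subr_eq0 mulrC -eqr_div // => /eqP ->.
Qed.

(* The equation [b P1 - a P2 = 0] of the fibre of [P1 / P2] over [a : b]. *)
Definition pencil {F : fieldType} (P1 P2 : {poly F}) (a b : F) : {poly F} :=
  b *: P1 - a *: P2.

(** * Fibres of [P1 / P2] as members of a pencil *)

Section Fibres.
Context {F : closedFieldType} {P1 P2 : {poly F}}.
Hypothesis (hP2 : P2 != 0) (hP : no_common_root P1 P2).
Hypothesis hdeg : (2 <= ratdeg P1 P2)%N.
Hypothesis hcrit : only_simple_critical_values P1 P2.
Let n := ratdeg P1 P2.
Let pen := pencil P1 P2.

Lemma size_ratdeg : maxn (size P1) (size P2) = n.+1.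
Proof. by rewrite /n /ratdeg prednK // (leq_trans _ (leq_maxr _ _)) ?size_poly_gt0. Qed.

Lemma size_pencil (a b : F) : (size (pen a b) <= n.+1)%N.
Proof.
rewrite (leq_trans (size_polyD _ _)) // size_polyN -size_ratdeg geq_max !leq_max.
by rewrite !size_scale_leq // orbT.
Qed.

(** This pair gives homogeneous coordinates of [P(oo)]. *)
Lemma lead_pair_neq0 : (P1`_n, P2`_n) != 0.
Proof.
rewrite xpair_eqE; apply/negP => /andP[/eqP e1 /eqP e2].
suff : (maxn (size P1) (size P2) <= n)%N by rewrite size_ratdeg ltnn.
rewrite geq_max; apply/andP; split; apply/leq_sizeP => j nj.
all: have [<- //|nj'] := eqVneq n j.
all: apply: nth_default; rewrite (@leq_trans n.+1) ?ltn_neqAle ?nj' //.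
all: by rewrite -size_ratdeg ?leq_maxl ?leq_maxr.
Qed.

Lemma value_pair_neq0 x : (P1.[x], P2.[x]) != 0.
Proof.
by rewrite xpair_eqE; apply/negP => /andP[r1 r2]; apply: (hP x).
Qed.

(** Otherwise [P1] would be a multiple of [P2]; then [P2] has degree [n >= 2], and any root of it is
    a common root. *)
Lemma pencil_neq0 {a b : F} : (a, b) != 0 -> pen a b != 0.
Proof.
rewrite xpair_eqE => ab0; apply/negP; rewrite subr_eq0 => /eqP e.
have [b0|b0] := eqVneq b 0.
  move: e ab0; rewrite b0 scale0r eqxx andbT => /esym/eqP.
  by rewrite scaler_eq0 (negPf hP2) orbF => ->.
have eP : P1 = (a / b) *: P2 by rewrite mulrC -scalerA -e scalerK.
have sP2 : size P2 = n.+1.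
  rewrite -size_ratdeg; apply/esym/maxn_idPr.
  by rewrite eP size_scale_leq.
have /closed_rootP[x rx] : size P2 != 1%N.
  by rewrite sP2 eqSS -lt0n (leq_trans _ hdeg).
by apply: (hP x); rewrite eP /root hornerZ (rootP rx) mulr0.
Qed.

(** The pencil member is read as a binary form of degree [n], which vanishes at infinity when its
    coefficient of degree [n] does. *)
Lemma ratmap_pencil {a b : F} (z : option F) : (a, b) != 0 ->
  ratmap P1 P2 z = (if b == 0 then None else Some (a / b)) <->
  match z with Some x => root (pen a b) x | None => (pen a b)`_n == 0 end.
Proof.
move=> ab0; case: z => [x|] /=.
  rewrite proj_eq ?value_pair_neq0 // /root /pen /pencil !hornerE.
  by split=> /eqP.
rewrite -/n proj_eq ?lead_pair_neq0 // /pen /pencil !coefE.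
by split=> /eqP.
Qed.

(* A fibre has at least [n - 1] points, whereas [pencil P1 P2 a b] has fewer than
   [size Q] roots, to which the point at infinity may have to be added. *)
Lemma pencil_factor_size {a b : F} {M Q : {poly F}} : (a, b) != 0 -> pen a b = M * Q ->
    (forall x, root M x -> root Q x) ->
  (n <= size Q + (size (pen a b) <= n))%N.
Proof.
move=> ab0 eG MQ; have G0 := pencil_neq0 ab0.
have [s us es] := closed_field_roots G0.
(* Roots of [M] are roots of [Q], so all finite points of the fibre are roots of [Q]. *)
have sQ : (size s < size Q)%N.
  apply: max_poly_roots => //; first by apply: contraNneq G0 => Q0; rewrite eG Q0 mulr0.
  apply/allP => x; rewrite es -topredE /= eG rootM => /orP[/MQ|] //.
pose s' := (if (pen a b)`_n == 0 then [:: None] else [::]) ++ map Some s.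
have us' : uniq s'.
  rewrite cat_uniq (map_inj_uniq (@Some_inj _)) us andbT has_sym.
  by case: ifP => //= _; rewrite orbF; apply/negP => /mapP[].
pose pt := if b == 0 then None else Some (a / b).
have fib : ratmap P1 P2 @^-1` [set pt] = [set` s'].
  apply/seteqP; split=> z /=; rewrite (ratmap_pencil _ ab0) mem_cat.
    case: z => [x rx|->//]; apply/orP; right.
    by apply: map_f; rewrite es.
  case: z => [x|]; last by case: ifP => //= _ /mapP[].
  case/orP; first by case: ifP.
  by rewrite (mem_map (@Some_inj _)) es.
have cs' := card_eq_uniq us'.
(* A fibre with fewer than [n] points lies over a critical value, which is simple, so it has exactly
   [n - 1] points. *)
have le_n : (n <= (size s').+1)%N.
  case: (leqP n (size s')) => [/leqW//|lt].
  have [] : simple_critical_value P1 P2 pt.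
    by apply: hcrit; exists (size s') => //; rewrite fib.
  move=> _; rewrite fib (card_eql cs') => /card_eq_II ->.
  by rewrite -/n prednK // (leq_trans _ hdeg).
apply: (leq_trans le_n); rewrite /s' size_cat size_map addnC -addSn leq_add //.
case: ifP => // /eqP Gn /=; rewrite lt0b.
apply/leq_sizeP => j nj; have [<- //|nj'] := eqVneq n j.
by apply: nth_default; rewrite (leq_trans (size_pencil _ _)) ?ltn_neqAle ?nj'.
Qed.

End Fibres.

(** * Syzygies and intersections in [P^1 x P^1] *)

(** By coprimality [q] divides [u], which is too small. The disjunction serves specializations in
    which one of the two polynomials loses degree. *)
Lemma coprimep_small_syzygy {F : fieldType} {p q u v : {poly F}} {m k : nat} :
    coprimep p q -> size p = m \/ size q = k ->
    (size u < k)%N -> (size v < m)%N -> u * p + v * q = 0 ->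
  u = 0 /\ v = 0.
Proof.
wlog : p q u v m k / size q = k.
  move=> W cpq [sp|sq] su sv e; last exact: (W p q u v m k _ cpq (or_intror sq)).
  have cqp : coprimep q p by rewrite coprimep_sym.
  have e' : v * q + u * p = 0 by rewrite addrC.
  by have [-> ->] := W q p v u k m sp cqp (or_intror sp) sv su e'.
move=> sq cpq _ su sv e.
have q0 : q != 0 by rewrite -size_poly_gt0 sq (leq_ltn_trans _ su).
have u0 : u = 0.
  apply/eqP; apply: contraTT su => u0; rewrite -leqNgt -sq dvdp_leq //.
  rewrite -(Gauss_dvdpl _ (_ : coprimep q p)) 1?coprimep_sym //.
  by rewrite (eqP (_ : u * p == - v * q)) ?dvdp_mull // mulNr -addr_eq0 e.
split=> //; move/eqP: e; rewrite u0 mul0r add0r mulf_eq0 (negPf q0) orbF.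
by move/eqP.
Qed.

(* The behaviour at infinity: if [U] or [V] is nonzero, the leading
   coefficients of [U * A] and [V * B] would have to cancel. *)
Lemma coprimep_lead_syzygy {F : fieldType} {A B U V : {poly {poly F}}} :
    (1 < size A)%N -> (1 < size B)%N -> coprimep (lead_coef A) (lead_coef B) ->
    size (lead_coef A) = sizeY A \/ size (lead_coef B) = sizeY B ->
    (sizeY U < sizeY B)%N -> (sizeY V < sizeY A)%N ->
    (size (U * A + V * B)%R <= 1)%N ->
  U = 0 /\ V = 0.
Proof.
move=> sA sB cAB full sU sV sC.
have nz (W D : {poly {poly F}}) : (1 < size D)%N -> W != 0 -> (1 < size (W * D)%R)%N.
  move=> sD W0; have D0 : D != 0 by rewrite -size_poly_gt0 (leq_trans _ sD).
  rewrite size_mul //; move: W0 sD; rewrite -size_poly_gt0.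
  by case: (size W) => // i _; rewrite addSn /= => /leq_trans ->; rewrite ?leq_addl.
have U0V0 : U = 0 -> V = 0.
  move=> U0; apply/eqP; apply: contraTT sC => V0.
  by rewrite U0 mul0r add0r -ltnNge nz.
have [U0|U0] := eqVneq U 0; first by rewrite U0V0.
have [V0|V0] := eqVneq V 0.
  by move: sC; rewrite V0 mul0r addr0 leqNgt nz.
have [s_eq|s_ne] := eqVneq (size (U * A)) (size (V * B)); last first.
  have: (1 < size (U * A + V * B)%R)%N.
    move: s_ne; rewrite neq_ltn => /orP[s_lt|s_lt].
      by rewrite addrC size_polyDl ?nz.
    by rewrite size_polyDl ?nz.
  by rewrite ltnNge sC.
have e : lead_coef U * lead_coef A + lead_coef V * lead_coef B = 0.
  rewrite -!lead_coefM !lead_coefE -s_eq -coefD nth_default //.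
  by rewrite (leq_trans sC) // -ltnS prednK ?nz // (leq_trans _ (nz _ _ sA U0)).
have [] // := coprimep_small_syzygy cAB full _ _ e.
- exact: leq_ltn_trans (max_size_lead_coefXY _) sU.
- exact: leq_ltn_trans (max_size_lead_coefXY _) sV.
- by move/eqP; rewrite lead_coef_eq0 (negPf U0).
Qed.

Lemma evalY_eq0_factor {F : fieldType} {u : {poly {poly F}}} {y : F} :
  map_poly (horner_eval y) u = 0 ->
  exists2 w : {poly {poly F}}, u = ('X - y%:P)%:P * w & (size w <= size u)%N.
Proof.
move=> u0; exists (map_poly (fun c => c %/ ('X - y%:P)) u); last exact: size_poly.
apply/polyP => i; rewrite coefCM coef_map_id0 ?div0p // mulrC divpK //.
by rewrite dvdp_XsubCl /root -[_.[_]]/(horner_eval y _) -coef_map u0 coef0.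
Qed.

Lemma horner_evalY {R : comNzRingType} (u : {poly {poly R}}) (x y : R) :
  (map_poly (horner_eval y) u).[x] = u.[x, y].
Proof. by rewrite -horner_swapXY horner2_swapXY. Qed.

(* [A] and [B] define curves in P^1 x P^1; the last four hypotheses exclude a
   common point, respectively at finite [(x, y)], on [x = oo], on [y = oo] and at
   [(oo, oo)].  The resultant gives [u A + v B = r(y)] with [deg_x u < deg_x B]
   and [deg_x v < deg_x A].  As no such relation holds between [A(., y0)] and
   [B(., y0)], a root [y0] of [r] can be divided out of [u], [v] and [r]; so [r]
   may be taken constant, which is excluded by the behaviour at [y = oo]. *)
Lemma P1xP1_bezout {F : closedFieldType} (A B : {poly {poly F}}) :
    (1 < size A)%N -> (1 < size B)%N -> (1 < sizeY A)%N -> (1 < sizeY B)%N ->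
    (forall x y, A.[x, y] = 0 -> B.[x, y] != 0) ->
    (forall y, root (lead_coef A) y -> (lead_coef B).[y] != 0) ->
    (forall x, root (lead_coef (swapXY A)) x ->
       (lead_coef (swapXY B)).[x] != 0) ->
    size (lead_coef (swapXY A)) = size A \/ size (lead_coef (swapXY B)) = size B ->
  False.
Proof.
move=> sA sB sYA sYB noz noy nox full.
have A0 : A != 0 by rewrite -size_poly_gt0 (leq_trans _ sA).
have B0 : B != 0 by rewrite -size_poly_gt0 (leq_trans _ sB).
(* Exchanging [x] and [y] makes [y] the main variable, so that leading coefficients describe the
   line [y = oo]. *)
have at_oo (u v : {poly {poly F}}) (r : {poly F}) :
    (size u < size B)%N -> (size v < size A)%N -> (size r <= 1)%N ->
    u * A + v * B = r%:P -> u = 0 /\ v = 0.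
  move=> su sv sr e.
  have [U0 V0] : swapXY u = 0 /\ swapXY v = 0.
    apply: (@coprimep_lead_syzygy _ (swapXY A) (swapXY B)).
    - by rewrite -sizeYE.
    - by rewrite -sizeYE.
    - exact: Pdiv.ClosedField.root_coprimep.
    - by rewrite !sizeYE !swapXYK.
    - by rewrite !sizeYE !swapXYK.
    - by rewrite !sizeYE !swapXYK.
    - by rewrite -!rmorphM -rmorphD /= e swapXY_polyC size_map_polyC.
  by split; apply/eqP; rewrite -swapXY_eq0 ?U0 ?V0.
have at_y (u v : {poly {poly F}}) (r : {poly F}) (y : F) :
    (size u < size B)%N -> (size v < size A)%N -> root r y ->
    u * A + v * B = r%:P ->
  map_poly (horner_eval y) u = 0 /\ map_poly (horner_eval y) v = 0.
  move=> su sv ry e.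
  apply: (@coprimep_small_syzygy _ (map_poly (horner_eval y) A)
            (map_poly (horner_eval y) B) _ _ (size A) (size B)).
  - apply: Pdiv.ClosedField.root_coprimep => x.
    by rewrite /root !horner_evalY => /eqP; apply: noz.
  (* The two leading coefficients do not both vanish at [y], so [A] or [B] keeps its [x]-degree
     there. *)
  - have [/noy ry'|ry'] := boolP (root (lead_coef A) y).
      by right; apply: size_map_poly_id0.
    by left; apply: size_map_poly_id0.
  - exact: leq_ltn_trans (size_poly _ _) su.
  - exact: leq_ltn_trans (size_poly _ _) sv.
  - by rewrite -!rmorphM -rmorphD e /= map_polyC /= horner_evalE (rootP ry).
have descent k (u v : {poly {poly F}}) (r : {poly F}) : (size r <= k)%N ->
    r != 0 -> (size u < size B)%N -> (size v < size A)%N ->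
    u * A + v * B <> r%:P.
  elim: k u v r => [|k IH] u v r sr r0 su sv e.
    by move: r0; rewrite -size_poly_leq0 sr.
  have [sr1|sr1] := leqP (size r) 1.
    have [u0 v0] := at_oo _ _ _ su sv sr1 e.
    by move/eqP: e; rewrite u0 v0 !mul0r addr0 eq_sym polyC_eq0 (negPf r0).
  have /closed_rootP[y ry] : size r != 1%N by rewrite gtn_eqF.
  have [] := at_y _ _ _ _ su sv ry e.
  move=> /evalY_eq0_factor[u' eu su'] /evalY_eq0_factor[v' ev sv'].
  have /factor_theorem[r' er] := ry.
  have Xy0 : ('X - y%:P)%:P != 0 :> {poly {poly F}}.
    by rewrite polyC_eq0 polyXsubC_eq0.
  have r'0 : r' != 0 by apply: contraNneq r0 => r'0; rewrite er r'0 mul0r.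
  apply: (IH u' v' r') => //; last 1 first.
  - apply: (mulfI Xy0); rewrite mulrDr !mulrA -eu -ev e er.
    by rewrite mulrC polyCM.
  - by move: sr; rewrite er size_mul ?polyXsubC_eq0 // size_XsubC addn2.
  - exact: leq_ltn_trans su' su.
  - exact: leq_ltn_trans sv' sv.
have [r0|r0] := eqVneq (resultant A B) 0; last first.
  have [[u v] /= [su sv] e] := resultant_in_ideal sA sB.
  exact: (descent _ u v _ (leqnn _) r0 su sv).
(* If the resultant vanishes, [A] and [B] share a factor [g] of positive [x]-degree, up to scalars
   [c], [d] in [F[y]]. The cofactors then give a relation with [r = 0], excluded at [y = oo]. *)
have := r0; move/eqP; rewrite resultant_eq0 => sg.
have := dvdp_gcdl A B; have := dvdp_gcdr A B.
move: sg; set g := gcdp A B => sg.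
move=> /Pdiv.Idomain.dvdpP[[c B'] /= c0 eB] /Pdiv.Idomain.dvdpP[[d A'] /= d0 eA].
have small (D D' : {poly {poly F}}) (k : {poly F}) : k != 0 -> D != 0 ->
    k *: D = D' * g -> D' != 0 /\ (size D' < size D)%N.
  move=> k0 D0 eD.
  have D'0 : D' != 0.
    apply: contraNneq D0 => D'0; move/eqP: eD.
    by rewrite D'0 mul0r scale_poly_eq0 (negPf k0).
  split=> //; have g0 : g != 0 by rewrite -size_poly_gt0 (leq_trans _ sg).
  rewrite -(size_scale D k0) eD size_mul //.
  by case: (size g) sg => [|[|m]] //= _; rewrite addnS /= addnS ltnS leq_addr.
have [B'0 sB'] := small _ _ _ c0 B0 eB; have [_ sA'] := small _ _ _ d0 A0 eA.
have [] := at_oo (d *: B') (- (c *: A')) 0.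
- by rewrite size_scale.
- by rewrite size_polyN size_scale.
- by rewrite size_poly0.
- rewrite polyC0 -scalerAl scalerAr eA mulNr -scalerAl scalerAr eB.
  by rewrite mulrCA subrr.
by move/eqP; rewrite scale_poly_eq0 (negPf d0) (negPf B'0).
Qed.

(** * From factors of [h_P] to multiple points of fibres *)

(** Both pencil members vanish at [y], so both belong to the point [P(y)] and are proportional; a
    double zero of the second is thus one of the first. *)
Lemma pencil_common_zero {F : closedFieldType} {P1 P2 Q Q' : {poly F}} {a b c d y : F} :
    no_common_root P1 P2 -> (c, d) != 0 -> pencil P1 P2 a b = ('X - y%:P) * Q ->
    pencil P1 P2 c d = ('X - y%:P) * Q' -> root Q' y ->
  root Q y.
Proof.
move=> hP cd0 e e' Q'y.
have X0 : 'X - y%:P != 0 by rewrite polyXsubC_eq0.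
have ey : b * P1.[y] = a * P2.[y].
  have /eqP := congr1 (fun p : {poly F} => p.[y]) e.
  by rewrite /pencil !hornerE subrr mul0r subr_eq0 => /eqP.
have ey' : d * P1.[y] = c * P2.[y].
  have /eqP := congr1 (fun p : {poly F} => p.[y]) e'.
  by rewrite /pencil !hornerE subrr mul0r subr_eq0 => /eqP.
have adbc : d * a = c * b.
  have v0 : (P1.[y], P2.[y]) != 0 := value_pair_neq0 hP y.
  apply/eqP; rewrite -subr_eq0; apply/eqP; move: v0.
  have [->|P2y _] := eqVneq P2.[y] 0; last first.
    apply: (mulIf P2y); rewrite mul0r mulrBl -!mulrA -ey.
    by rewrite mulrCA ey' mulrCA subrr.
  have [->|P1y _] := eqVneq P1.[y] 0; first by rewrite eqxx.
  apply: (mulIf P1y); rewrite mul0r mulrBl -!mulrA ey.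
  by rewrite mulrCA ey' mulrCA subrr.
have dQ : d *: Q = b *: Q'.
  apply: (mulfI X0); rewrite -!scalerAr -e -e' /pencil !scalerBr !scalerA.
  by rewrite adbc [b * d]mulrC [b * c]mulrC.
have cQ : c *: Q = a *: Q'.
  apply: (mulfI X0); rewrite -!scalerAr -e -e' /pencil !scalerBr !scalerA.
  by rewrite -adbc [a * d]mulrC [a * c]mulrC.
move: cd0; rewrite xpair_eqE negb_and => /orP[c0|d0].
  by rewrite -(rootZ _ _ c0) cQ /root hornerZ (rootP Q'y) mulr0.
by rewrite -(rootZ _ _ d0) dQ /root hornerZ (rootP Q'y) mulr0.
Qed.

(** Both [h_num] and ['X - 'Y] change sign when [x] and [y] are exchanged. *)
Lemma swapXY_h_poly {F : fieldType} (P1 P2 : {poly F}) :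
  swapXY (h_poly P1 P2) = h_poly P1 P2.
Proof.
have X0 : 'X - 'Y != 0 :> {poly {poly F}} by rewrite polyXsubC_eq0.
apply: (mulIf X0); rewrite h_polyK.
have eX : 'X - 'Y = - swapXY ('X - 'Y) :> {poly {poly F}}.
  by rewrite rmorphB /= swapXY_X swapXY_Y opprB.
rewrite {1}eX mulrN -rmorphM /=.
rewrite h_polyK /h_num rmorphB !rmorphM /= !swapXY_polyC !swapXY_map_polyC.
by rewrite opprB mulrC [_ * P2^:P]mulrC.
Qed.

Section Factors.
Context {F : closedFieldType} {P1 P2 : {poly F}}.
Hypothesis (hP2 : P2 != 0) (hP : no_common_root P1 P2).
Hypothesis hdeg : (2 <= ratdeg P1 P2)%N.
Hypothesis hcrit : only_simple_critical_values P1 P2.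
Let n := ratdeg P1 P2.
Let pen := pencil P1 P2.

(** The link between [h_P] and fibres: on a horizontal line the curve is the fibre through [y] with
    one copy of [y] removed. *)
Lemma evalY_h_poly y :
  pen P1.[y] P2.[y] = ('X - y%:P) * map_poly (horner_eval y) (h_poly P1 P2).
Proof.
rewrite mulrC -[X in _ * X](_ : map_poly (horner_eval y) ('X - 'Y) = _); last first.
  by rewrite rmorphB /= map_polyX map_polyC /= horner_evalE hornerX.
rewrite -rmorphM h_polyK /h_num rmorphB !rmorphM /= !map_polyC /= !horner_evalE.
have ev p : map_poly (horner_eval y) p^:P = p.
  by rewrite -map_poly_comp map_poly_id // => c _ /=; rewrite horner_evalE hornerC.
by rewrite !ev /pen /pencil -!mul_polyC [P1 * _]mulrC [P2 * _]mulrC.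
Qed.

(** The leading coefficient describes the curve on [x = oo], where it is the fibre over [P(oo)]. *)
Lemma size_h_poly : size (h_poly P1 P2) = n /\
  lead_coef (h_poly P1 P2) = - pen P1`_n P2`_n.
Proof.
have cf i : (h_num P1 P2)`_i = - pen P1`_i P2`_i.
  by rewrite /h_num coefB !coefMC !coef_map /= /pen /pencil opprB !mul_polyC.
have cn0 : - pen P1`_n P2`_n != 0.
  by rewrite oppr_eq0 (pencil_neq0 hP2 hP hdeg) // lead_pair_neq0.
have sn : size (h_num P1 P2) = n.+1.
  apply/eqP; rewrite eqn_leq; apply/andP; split; last first.
    by rewrite ltnNge; apply: contraNN cn0 => sn; rewrite -cf nth_default.
  apply/leq_sizeP => j nj; rewrite cf.
  have [-> ->] : P1`_j = 0 /\ P2`_j = 0.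
    by split; apply: nth_default; rewrite (leq_trans _ nj) //
      -/n -(size_ratdeg hP2) ?leq_maxl ?leq_maxr.
  by rewrite /pen /pencil !scale0r subrr oppr0.
have mX := monicXsubC ('X : {poly F}).
split; last first.
  by rewrite -(lead_coef_Mmonic (h_poly P1 P2) mX) h_polyK lead_coefE sn /= cf.
have h0 : h_poly P1 P2 != 0.
  apply/eqP => h0; move: sn; rewrite -h_polyK h0 mul0r size_poly0 => /eqP.
  by [].
by apply: succn_inj; rewrite -sn -h_polyK size_Mmonic // size_XsubC addn2.
Qed.

Context {A B : {poly {poly F}}}.
Hypothesis hAB : h_poly P1 P2 = A * B.

Lemma factor_size : [/\ A != 0, B != 0 & (size A + size B)%N = n.+1].
Proof.
have [sn _] := size_h_poly.
have : A * B != 0 by rewrite -hAB -size_poly_gt0 sn (leq_trans _ hdeg).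
rewrite mulf_eq0 negb_or => /andP[A0 B0]; split=> //.
by rewrite -sn hAB size_mul // prednK // addn_gt0 size_poly_gt0 A0.
Qed.

(** A nonunit factor depending on [y] alone has a root [y], at which the pencil member over [P(y)]
    would be zero. *)
Lemma factor_size_gt1 : A \isn't a GRing.unit -> (1 < size A)%N.
Proof.
move=> Au; rewrite ltnNge; apply: contra Au => /size1_polyC eA.
have [A0 _ _] := factor_size.
have c0 : A`_0 != 0 by rewrite -polyC_eq0 -eA.
have [/eqP s1|/closed_rootP[y /rootP Ay]] := boolP (size A`_0 == 1%N).
  rewrite poly_unitE {1}eA size_polyC c0 poly_unitE s1 !eqxx /= unitfE.
  by move: c0; rewrite -lead_coef_eq0 lead_coefE s1.
have := pencil_neq0 hP2 hP hdeg (value_pair_neq0 hP y).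
rewrite -/pen evalY_h_poly hAB rmorphM eA /= map_polyC /= horner_evalE Ay.
by rewrite mul0r mulr0 eqxx.
Qed.

Lemma factor_common_zero x y : A.[x, y] = 0 -> B.[x, y] != 0.
Proof.
move=> Axy; apply/negP => /eqP Bxy; pose ey := map_poly (horner_eval y).
have /factor_theorem[A1 eA] : root (ey A) x by rewrite /root horner_evalY Axy.
have /factor_theorem[B1 eB] : root (ey B) x by rewrite /root horner_evalY Bxy.
pose Q := ('X - x%:P) * (A1 * B1).
have eh : ey (h_poly P1 P2) = ('X - x%:P) * Q.
  by rewrite hAB /ey rmorphM /= -!/(ey _) eA eB /Q; ring.
have y0 := value_pair_neq0 hP y.
(* If [x = y], this is a triple point of the fibre. If not, [y] is a double zero on the vertical
   line through [x], so a double point of the common fibre of [x] and [y]. *)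
have Qy : root Q y.
  have [<-|xy] := eqVneq x y; first by rewrite rootM root_XsubC eqxx.
  pose ex u := map_poly (horner_eval x) (swapXY u).
  have /factor_theorem[A2 eA2] : root (ex A) y.
    by rewrite /root horner_evalY horner2_swapXY Axy.
  have /factor_theorem[B2 eB2] : root (ex B) y.
    by rewrite /root horner_evalY horner2_swapXY Bxy.
  have ex_h : pen P1.[x] P2.[x] =
      ('X - y%:P) * (('X - y%:P) * (A2 * B2 * ('X - x%:P))).
    rewrite evalY_h_poly -swapXY_h_poly hAB !rmorphM /= -!/(ex _) eA2 eB2.
    by ring.
  have := pencil_common_zero hP (value_pair_neq0 hP x) (evalY_h_poly y) ex_h.
  rewrite -/ey eh !rootM !root_XsubC eqxx => /(_ isT).
  by rewrite eq_sym (negPf xy).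
have eG : pen P1.[y] P2.[y] = ('X - y%:P) * ('X - x%:P) * Q.
  by rewrite evalY_h_poly -/ey eh mulrA.
have MQ z : root (('X - y%:P) * ('X - x%:P)) z -> root Q z.
  rewrite rootM !root_XsubC => /orP[/eqP-> //|/eqP->].
  by rewrite rootM root_XsubC eqxx.
(* The pencil member has size [size Q + 2 <= n + 1], so [size Q <= n - 1], strictly if infinity is
   in the fibre; the bound fails either way. *)
clearbody Q; have := pencil_factor_size hP2 hP hdeg hcrit y0 eG MQ.
have : (size (pen P1.[y] P2.[y]) <= n.+1)%N by apply: size_pencil.
have := pencil_neq0 hP2 hP hdeg y0.
rewrite -/pen eG mulf_eq0 negb_or => /andP[X0 Q0]; rewrite (size_mul X0 Q0).
rewrite size_mul ?polyXsubC_eq0 // !size_XsubC.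
by move: hdeg; rewrite -/n; set k := size Q; lia.
Qed.

(** At a common point [(oo, y)] the fibre through [y] would contain both [oo] and [y] with
    multiplicity at least 2. *)
Lemma factor_common_lead y : root (lead_coef A) y -> (lead_coef B).[y] != 0.
Proof.
move=> rA; apply/negP => rB; pose ey := map_poly (horner_eval y).
have [A0 B0 sAB] := factor_size; have [sh lh] := size_h_poly.
have y0 := value_pair_neq0 hP y.
have small (D : {poly {poly F}}) : D != 0 -> root (lead_coef D) y ->
    (size (ey D) < size D)%N.
  rewrite -size_poly_gt0 => D0 rD; rewrite -[X in (_ < X)%N]prednK // ltnS.
  apply/leq_sizeP => j; rewrite coef_map /= leq_eqVlt => /orP[/eqP <-|Dj].
    exact/eqP.
  by rewrite nth_default ?rmorph0 // -(prednK D0).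
(* Each factor loses at least one degree in [x], so [oo] is a double point of the fibre. *)
have sey : (size (ey (h_poly P1 P2)) <= n - 2)%N.
  rewrite hAB /ey rmorphM /=; apply: leq_trans (size_polyMleq _ _) _.
  have := small _ A0 rA; have := small _ B0 rB; move: sAB.
  have arith a b c d m : (1 < m -> c + d = m.+1 -> b < d -> a < c ->
    (a + b).-1 <= m - 2)%N by lia.
  exact: arith.
have /factor_theorem[A1 eA] := rA; have /factor_theorem[B1 eB] := rB.
have el : pen P1`_n P2`_n = ('X - y%:P) * (- (A1 * B1) * ('X - y%:P)).
  rewrite -[LHS]opprK -lh hAB lead_coefM eA eB; ring.
have := pencil_common_zero hP (lead_pair_neq0 hP2) (evalY_h_poly y) el.
rewrite rootM root_XsubC eqxx orbT => /(_ isT) hy.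
have MQ z : root ('X - y%:P) z -> root (ey (h_poly P1 P2)) z.
  by rewrite root_XsubC => /eqP ->.
have := pencil_factor_size hP2 hP hdeg hcrit y0 (evalY_h_poly y) MQ.
have arith s (b : bool) m : (1 < m -> s <= m - 2 -> m <= s + b -> False)%N.
  by case: b; lia.
exact: arith hdeg sey.
Qed.

(** If both equalities fail, both curves pass through [(oo, oo)], and [oo] has multiplicity at least
    3 in its own fibre. *)
Lemma factor_corner :
  size (lead_coef A) = sizeY A \/ size (lead_coef B) = sizeY B.
Proof.
have [A0 B0 _] := factor_size; have [sh lh] := size_h_poly.
have sYAB : (sizeY A + sizeY B)%N = n.+1.
  have hs : swapXY A * swapXY B = h_poly P1 P2.
    by rewrite -rmorphM -hAB /= swapXY_h_poly.
  rewrite !sizeYE -sh -hs size_mul ?swapXY_eq0 // prednK // addn_gt0.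
  by rewrite size_poly_gt0 swapXY_eq0 A0.
have [|sA] := eqVneq (size (lead_coef A)) (sizeY A); first by left.
have [|sB] := eqVneq (size (lead_coef B)) (sizeY B); first by right.
have {}sA : (size (lead_coef A) < sizeY A)%N.
  by rewrite ltn_neqAle sA max_size_lead_coefXY.
have {}sB : (size (lead_coef B) < sizeY B)%N.
  by rewrite ltn_neqAle sB max_size_lead_coefXY.
have sp : (size (pen P1`_n P2`_n) <= n - 2)%N.
  rewrite -size_polyN -lh hAB lead_coefM.
  apply: leq_trans (size_polyMleq _ _) _; move: sYAB sA sB.
  have arith a b c d m : (1 < m -> c + d = m.+1 -> a < c -> b < d ->
    (a + b).-1 <= m - 2)%N by lia.
  exact: arith.
(* Only the loss of degree at infinity is used here, so [M] is taken to be 1, which has no roots. *)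
have M1 z : root (1 : {poly F}) z -> root (pen P1`_n P2`_n) z by move=> r1; have := root1 z; rewrite r1.
have := pencil_factor_size hP2 hP hdeg hcrit (lead_pair_neq0 hP2)
  (esym (mul1r _)) M1.
have arith s (b : bool) m : (1 < m -> s <= m - 2 -> m <= s + b -> False)%N.
  by case: b; lia.
move=> /(arith _ _ _ hdeg sp) [].
Qed.

End Factors.

(** * Irreducibility *)

Lemma h_poly_irreducible {F : closedFieldType} (P1 P2 : {poly F}) :
    P2 != 0 -> no_common_root P1 P2 -> (2 <= ratdeg P1 P2)%N ->
    only_simple_critical_values P1 P2 ->
  irreducible_elt (h_poly P1 P2).
Proof.
move=> hP2 hP hdeg hcrit; have [sh _] := size_h_poly hP2 hP hdeg; split.
- by rewrite -size_poly_gt0 sh (leq_trans _ hdeg).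
- by rewrite poly_unitE sh gtn_eqF.
move=> A B hAB; have hBA : h_poly P1 P2 = B * A by rewrite mulrC.
(* By symmetry of [h_P] the swapped factors also factor it, so the results on [x]-degrees and on
   [x = oo] carry over to [y]. *)
have hs : h_poly P1 P2 = swapXY A * swapXY B.
  by rewrite -rmorphM -hAB /= swapXY_h_poly.
have hs' : h_poly P1 P2 = swapXY B * swapXY A by rewrite mulrC.
have swu (u : {poly {poly F}}) : swapXY u \is a GRing.unit -> u \is a GRing.unit.
  move=> /unitrPr[v uv]; apply/unitrPr; exists (swapXY v).
  by rewrite -[u]swapXYK -rmorphM uv rmorph1.
have [Au|Au] := boolP (A \is a GRing.unit); first by left.
have [Bu|Bu] := boolP (B \is a GRing.unit); first by right.
exfalso; apply: (@P1xP1_bezout _ A B).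
- exact: factor_size_gt1 hAB Au.
- exact: factor_size_gt1 hBA Bu.
- by rewrite sizeYE; apply: factor_size_gt1 hs (contra (@swu A) Au).
- by rewrite sizeYE; apply: factor_size_gt1 hs' (contra (@swu B) Bu).
- exact: factor_common_zero hAB.
- exact: factor_common_lead hAB.
- exact: factor_common_lead hs.
- by have := factor_corner hP2 hP hdeg hcrit hs; rewrite !sizeYE !swapXYK.
Qed.

Theorem corollary3p1 (R : realType) (P1 P2 : {poly R[i]})
    (hP2 : P2 != 0) (hP : no_common_root P1 P2)
    (hdeg : (2 <= ratdeg P1 P2)%N)
    (hcrit : only_simple_critical_values P1 P2) :
  irreducible_curve (h_poly P1 P2).
Proof. exact: h_poly_irreducible. Qed.
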